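(* ČF$T_{2\frac12}$ is a fuzzy closure property: if $\theta:(X,c)\to(Y,d)$ is a ČF-homeomorphism between fuzzy closure spaces and $(X,c)$ is ČF$T_{2\frac12}$, then $(Y,d)$ is ČF$T_{2\frac12}$.
   Context: $I=[0,1]$; a fuzzy (sub)set of a non-empty set $X$ is a map $f:X\to I$, and $I^X$ is the set of all of them, ordered pointwise, with $\vee,\wedge$ pointwise supremum/infimum. $\underline 0$ is the constant $0$ fuzzy set; the complement is $\mathfrak{Co}(f)(x)=1-f(x)$. For $x\in X$ and $0<\lambda\le1$, the fuzzy point $x_\lambda$ has value $\lambda$ at $x$ and $0$ elsewhere; $x_\lambda\in f$ means $x_\lambda\le f$, i.e. $\lambda\le f(x)$. Fuzzy points $x_\lambda,y_\gamma$ are distinct if $x\ne y$. A fuzzy closure space is a pair $(X,c)$ with $X$ a non-empty set and $c:I^X\to I^X$ satisfying $c(\underline 0)=\underline 0$, $f\le c(f)$, and $c(f\vee g)=c(f)\vee c(g)$ for all $f,g\in I^X$ (idempotency is not required). For $\theta:X\to Y$ and $f\in I^X$, $\theta(f)(y)=\sup\{f(x):\theta(x)=y\}$ if $\theta^{-1}(y)\ne\emptyset$, and $0$ otherwise. $\theta:(X,c)\to(Y,d)$ is ČF-continuous if $\theta(c(f))\le d(\theta(f))$ for all $f\in I^X$; it is a ČF-homeomorphism if it is bijective and both $\theta$ and $\theta^{-1}$ are ČF-continuous. A fuzzy closure property is a property of fuzzy closure spaces preserved by ČF-homeomorphisms. The interior is $\operatorname{int}(f)=\mathfrak{Co}(c(\mathfrak{Co}(f)))$;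 $f$ is a neighborhood of a fuzzy point $x_\lambda$ if $x_\lambda\le\operatorname{int}(f)$. $(X,c)$ is ČF$T_{2\frac12}$ (ČF-Urysohn) if for every two distinct fuzzy points $x_\lambda,y_\gamma$ there are neighborhoods $f$ of $x_\lambda$ and $g$ of $y_\gamma$ such that $c(f)\le\mathfrak{Co}(c(g))$, $x_\lambda\in f\le\mathfrak{Co}(y_\gamma)$ and $y_\gamma\in g\le\mathfrak{Co}(x_\lambda)$. *)

(* Defs.v *)
(* MathComp-Analysis; the unit interval is {i01 R} for an arbitrary R : realType. *)
From mathcomp Require Import all_boot all_order all_algebra.
From mathcomp Require Import boolp classical_sets interval_inference reals.

Set Implicit Arguments.
Unset Strict Implicit.
Unset Printing Implicit Defensive.

Import Order.TTheory GRing.Theory Num.Theory.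
Local Open Scope classical_set_scope.
Local Open Scope ring_scope.

(* The pointwise order (f <= g)%O and the pointwise supremum (f `|` g)%O are
   those that boolp (module FunOrder) puts on functions into a lattice. *)
Definition fuzzySet (R : realType) (X : Type) : Type := X -> {i01 R}.

Section FuzzySets.
Context {R : realType}.

Definition fzero (X : Type) : fuzzySet R X := fun=> 0%:i01.

Definition fcompl (X : Type) (f : fuzzySet R X) : fuzzySet R X :=
  fun x => (1 - (f x)%:num)%:i01.

(* Meant for 0 < l only: the theory does not regard [fpoint x 0], the zero
   fuzzy set, as a fuzzy point. *)
Definition fpoint (X : Type) (x : X) (l : {i01 R}) : fuzzySet R X :=
  fun y => if `[< y = x >] then l else 0%:i01.

Definition fiber_values (X Y : Type) (theta : X -> Y) (f : fuzzySet R X)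
  (y : Y) : set R := [set (f x)%:num | x in theta @^-1` [set y]].

Lemma sup_fiber_values_ge0 (X Y : Type) (theta : X -> Y) (f : fuzzySet R X)
  (y : Y) : 0 <= sup (fiber_values theta f y).
Proof.
have [->|/set0P [r rA]] := eqVneq (fiber_values theta f y) set0.
  by rewrite sup0.
apply: (@le_trans _ _ r); first by case: rA => x _ <-.
by apply: ub_le_sup => //; exists 1 => _ [x _ <-].
Qed.

Lemma sup_fiber_values_le1 (X Y : Type) (theta : X -> Y) (f : fuzzySet R X)
  (y : Y) : sup (fiber_values theta f y) <= 1.
Proof.
have [->|/set0P ne] := eqVneq (fiber_values theta f y) set0.
  by rewrite sup0.
by apply: ge_sup => // _ [x _ <-].
Qed.

Definition fimage (X Y : Type) (theta : X -> Y) (f : fuzzySet R X) :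
    fuzzySet R Y := fun y =>
  if `[< theta @^-1` [set y] !=set0 >] then
    Itv01 (sup_fiber_values_ge0 theta f y) (sup_fiber_values_le1 theta f y)
  else 0%:i01.

End FuzzySets.

(* The operator need not be idempotent. *)
Record fuzzyClosureSpace (R : realType) := FuzzyClosureSpace {
  fcarrier :> Type ;
  fcl : fuzzySet R fcarrier -> fuzzySet R fcarrier ;
  fcarrier_nonempty : inhabited fcarrier ;
  fcl0 : fcl (@fzero R fcarrier) = @fzero R fcarrier ;
  fcl_ext : forall f, (f <= fcl f)%O ;
  fclU : forall f g, fcl (f `|` g)%O = (fcl f `|` fcl g)%O
}.

Section FuzzyClosureSpaces.
Context {R : realType}.
Implicit Types S T : fuzzyClosureSpace R.

Definition CF_continuous S T (theta : S -> T) : Prop :=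
  forall f : fuzzySet R S, (fimage theta (fcl f) <= fcl (fimage theta f))%O.

Definition CF_homeomorphism S T (theta : S -> T) : Prop :=
  exists theta' : T -> S, [/\ cancel theta theta', cancel theta' theta,
    CF_continuous theta & CF_continuous theta'].

Definition fuzzy_closure_property (P : fuzzyClosureSpace R -> Prop) : Prop :=
  forall S T (theta : S -> T), CF_homeomorphism theta -> P S -> P T.

Definition finterior S (f : fuzzySet R S) : fuzzySet R S :=
  fcompl (fcl (fcompl f)).

Definition fneighborhood S (f : fuzzySet R S) (x : S) (l : {i01 R}) : Prop :=
  (fpoint x l <= finterior f)%O.

Definition CF_Urysohn S : Prop :=
  forall (x y : S) (l m : {i01 R}), 0 < l%:num -> 0 < m%:num -> x <> y ->
  exists f g : fuzzySet R S,
    [/\ fneighborhood f x l, fneighborhood g y m,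
        (fcl f <= fcompl (fcl g))%O,
        (fpoint x l <= f)%O /\ (f <= fcompl (fpoint y m))%O &
        (fpoint y m <= g)%O /\ (g <= fcompl (fpoint x l))%O].

End FuzzyClosureSpaces.

(* Main.v *)
(* A homeomorphism with inverse [theta'] carries [f] to [f \o theta'], and
   continuity in both directions makes the closure commute with
   precomposition by [theta'].  Every clause of the Urysohn property is then
   transported by precomposing with [theta']. *)
Require Import Defs.
From mathcomp Require Import all_boot all_order all_algebra.
From mathcomp Require Import boolp classical_sets interval_inference reals.

(** Each fiber of a bijection is a singleton, so the supremum runs over a single value and the
    default 0 never occurs. *)
Lemma fimage_can (R : realType) (X Y : Type) (theta : X -> Y) (theta' : Y -> X)
    (f : fuzzySet R X) :
  cancel theta theta' -> cancel theta' theta -> fimage theta f = f \o theta'.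
Proof.
move=> thetaK theta'K; apply/funext => y; apply/val_inj; rewrite /fimage.
have fiberE : (theta @^-1` [set y] = [set theta' y])%classic.
  by apply/seteqP; split => [x /= <-|x /= ->]; rewrite ?thetaK ?theta'K.
case: asboolP => [_|[]]; last by exists (theta' y); rewrite /= theta'K.
by rewrite /= /fiber_values fiberE image_set1 sup1.
Qed.

Lemma comp_lef (R : realType) (X Y : Type) (h : Y -> X) (f g : fuzzySet R X) :
  (f <= g)%O -> (f \o h <= g \o h :> fuzzySet R Y)%O.
Proof. by move=> /lefP fg; apply/lefP => y; exact: fg. Qed.

Lemma fpoint_comp (R : realType) (X Y : Type) (h : X -> Y) (x : X)
    (l : {i01 R}) : injective h -> fpoint (h x) l \o h = fpoint x l.
Proof.
move=> h_inj; apply/funext => z; rewrite /fpoint /=.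
by have -> : (h z = h x) = (z = x) by apply/propext; split=> [/h_inj|->].
Qed.

Lemma fcl_comp (R : realType) (S T : fuzzyClosureSpace R) (theta : S -> T)
    (theta' : T -> S) (f : fuzzySet R S) :
    cancel theta theta' -> cancel theta' theta ->
    CF_continuous theta -> CF_continuous theta' ->
  fcl (f \o theta' : fuzzySet R T) = fcl f \o theta'.
Proof.
move=> thetaK theta'K ctheta ctheta'; apply/Order.POrderTheory.le_anti/andP; split; last first.
  by have := ctheta f; rewrite !(fimage_can _ _ _ _ _ _ thetaK theta'K).
(* For the other inequality, continuity of [theta'] at [f \o theta'] bounds
   [fcl (f \o theta') \o theta] by [fcl f]; precomposing with [theta'] cancels [theta]. *)
have := ctheta' (f \o theta').
rewrite !(fimage_can _ _ _ _ _ _ theta'K thetaK) => /(comp_lef _ _ _ theta').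
have -> : (f \o theta') \o theta = f by apply/funext => x /=; rewrite thetaK.
suff -> : (fcl (f \o theta' : fuzzySet R T) \o theta) \o theta' =
    fcl (f \o theta' : fuzzySet R T) by [].
by apply/funext => y /=; rewrite theta'K.
Qed.

Theorem theorem6p6 (R : realType) : fuzzy_closure_property (@CF_Urysohn R).
Proof.
move=> S T theta [theta' [thetaK theta'K ctheta ctheta']] US x y l m l0 m0 xy.
have inj := can_inj theta'K.
have clE f := fcl_comp _ _ _ _ _ f thetaK theta'K ctheta ctheta'.
have intE f : finterior (f \o theta' : fuzzySet R T) = finterior f \o theta'.
  (* Complements act on values only, so they commute with precomposition by conversion. *)
  by rewrite /finterior -[fcompl (f \o theta')]/(fcompl f \o theta') clE.
have [|f [g [nf ng fg [xf fy] [yg gx]]]] := US (theta' x) (theta' y) l m l0 m0.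
  by move=> /inj.
exists (f \o theta'), (g \o theta'); rewrite /fneighborhood !clE !intE.
(* Writing the fuzzy points of [T] as pullbacks along [theta'] turns every clause into a pulled-back
   inequality of [S]. *)
rewrite -!(fpoint_comp _ _ _ _ _ _ inj).
have le_comp := comp_lef _ _ _ theta'.
split; [exact: le_comp nf|exact: le_comp ng|exact: le_comp fg| |].
- by split; [exact: le_comp xf|exact: le_comp fy].
- by split; [exact: le_comp yg|exact: le_comp gx].
Qed.
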